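(* Let $P$ be a finite non-empty poset, $p$ the number of filters of $P$, and $L$ a finite lattice. Let $(L^P, \alpha)$ be a multi-lattice with $\alpha(\hat{1}_{L^P}) = 1$, and let $n \geq 1$ be an integer. If for every join-irreducible $a \in L$, $\left|L^P \setminus [a)^P\right|_\alpha \leq n$, then $\left|L^P\right|_\alpha \leq M(n)$, where $$M(n) = \begin{cases} \max\{kn - p^{k-1}(k(p-1) - p) \mid k \geq 1 \text{ an integer and } p^{k-1}(p-1) \leq n\} & \text{if } n \geq p-1, \\ 1 & \text{otherwise.}\end{cases}$$ This bound is best possible: for every such $P$ and every $n \geq 1$ there exist $L$ and $\alpha$ satisfying the hypotheses with $\left|L^P\right|_\alpha = M(n)$.
   Context: $L^P$ is the set of order-preserving maps from $P$ to $L$, ordered pointwise (a lattice when $L$ is), with greatest element $\hat{1}_{L^P}$. For $a\in L$, $[a) = \{u \in L \mid u \geq a\}$, and $[a)^P \subseteq L^P$ is the set of order-preserving maps from $P$ into $[a)$. An element $a$ is join-irreducible iff $a = v \vee w$ implies $a = v$ or $a = w$. A filter of $P$ is an up-closed subset (possibly empty). A multi-lattice $(K,\alpha)$ consists of a lattice $K$ and a function $\alpha : K \to \{1,2,3,\dots\}$; for $S \subseteq K$, $|S|_\alpha = \sum_{u \in S} \alpha(u)$. *)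

(* Defs.v *)
From HB Require Import structures.
From mathcomp Require Import all_boot all_order all_algebra zify.
Set Implicit Arguments.
Unset Strict Implicit.
Unset Printing Implicit Defensive.
Import Order.TTheory GRing.Theory Num.Theory.

Section OrderPreservingMaps.
Local Open Scope order_scope.
(* A non-empty finite lattice has a bottom and a top element, so the finite
   lattices that are not empty are exactly those of type finTBLatticeType. *)
Variables (dP dL : Order.disp_t) (P : finPOrderType dP) (L : finTBLatticeType dL).

Definition order_preserving (f : {ffun P -> L}) : bool :=
  [forall x, forall y, (x <= y) ==> (f x <= f y)].

Record omap := OMap {
  omap_ffun :> {ffun P -> L};
  omap_preserving : order_preserving omap_ffun }.

HB.instance Definition _ := [isSub for omap_ffun].
HB.instance Definition _ := [Finite of omap by <:].

Lemma omap_le (f : omap) x y : x <= y -> f x <= f y.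
Proof. by move: (omap_preserving f) => /forallP/(_ x)/forallP/(_ y)/implyP. Qed.

Definition leom (f g : omap) : bool := [forall x, f x <= g x].

Lemma leomP (f g : omap) : reflect (forall x, f x <= g x) (leom f g).
Proof. exact: forallP. Qed.

Fact leom_refl : reflexive leom.
Proof. by move=> f; apply/leomP. Qed.

Fact leom_anti : antisymmetric leom.
Proof.
move=> f g /andP[/leomP fg /leomP gf]; apply/val_inj/ffunP => x.
by apply/le_anti; rewrite fg gf.
Qed.

Fact leom_trans : transitive leom.
Proof.
move=> g f h /leomP fg /leomP gh; apply/leomP => x.
exact: le_trans (fg x) (gh x).
Qed.

HB.instance Definition _ :=
  Order.Le_isPOrder.Build dL omap leom_refl leom_anti leom_trans.

Fact omap_meet_subproof (f g : omap) :
  order_preserving [ffun x => f x `&` g x].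
Proof.
by apply/forallP => x; apply/forallP => y; apply/implyP => xy;
  rewrite !ffunE leI2 // omap_le.
Qed.

Fact omap_join_subproof (f g : omap) :
  order_preserving [ffun x => f x `|` g x].
Proof.
by apply/forallP => x; apply/forallP => y; apply/implyP => xy;
  rewrite !ffunE leU2 // omap_le.
Qed.

Fact omap_const_subproof (a : L) : order_preserving [ffun=> a].
Proof.
by apply/forallP => x; apply/forallP => y; apply/implyP => _; rewrite !ffunE.
Qed.

Definition omap_meet f g := OMap (omap_meet_subproof f g).
Definition omap_join f g := OMap (omap_join_subproof f g).
Definition omap_const a := OMap (omap_const_subproof a).

Fact omap_meetP (f g h : omap) : (f <= omap_meet g h) = (f <= g) && (f <= h).
Proof.
apply/leomP/andP => [H|[/leomP fg /leomP fh] x]; last first.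
  by rewrite ffunE lexI fg fh.
by split; apply/leomP => x; have:= H x; rewrite ffunE lexI => /andP[].
Qed.

Fact omap_joinP (f g h : omap) : (omap_join f g <= h) = (f <= h) && (g <= h).
Proof.
apply/leomP/andP => [H|[/leomP fh /leomP gh] x]; last first.
  by rewrite ffunE leUx fh gh.
by split; apply/leomP => x; have:= H x; rewrite ffunE leUx => /andP[].
Qed.

HB.instance Definition _ :=
  Order.POrder_MeetJoin_isLattice.Build dL omap omap_meetP omap_joinP.

Fact omap_le0 (f : omap) : omap_const \bot <= f.
Proof. by apply/leomP => x; rewrite ffunE le0x. Qed.

Fact omap_le1 (f : omap) : f <= omap_const \top.
Proof. by apply/leomP => x; rewrite ffunE lex1. Qed.

HB.instance Definition _ := Order.hasBottom.Build dL omap omap_le0.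
HB.instance Definition _ := Order.hasTop.Build dL omap omap_le1.

Definition maps_into (A : {set L}) : {set omap} :=
  [set f : omap | [forall x, f x \in A]].

End OrderPreservingMaps.

Notation "{ 'omap' P '->' L }" := (@omap _ _ P L)
  (at level 0, P at level 98, L at level 99, format "{ 'omap'  P  ->  L }") : type_scope.

Section Lattices.
Local Open Scope order_scope.

(* The bottom element is join-irreducible in this sense. *)
Definition join_irreducible d (L : latticeType d) (a : L) : Prop :=
  forall v w : L, a = v `|` w -> a = v \/ a = w.

Definition upper_set d (L : finPOrderType d) (a : L) : {set L} :=
  [set u | a <= u].

Definition is_filter d (P : finPOrderType d) (F : {set P}) : bool :=
  [forall x in F, forall y, (x <= y) ==> (y \in F)].

Definition num_filters d (P : finPOrderType d) : nat :=
  #|[set F : {set P} | is_filter F]|.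

End Lattices.

(* A weight function K -> {1, 2, 3, ...} is encoded as a positive nat-valued one. *)
Definition multilattice d (K : latticeType d) (alpha : K -> nat) : Prop :=
  forall u : K, (0 < alpha u)%N.

Definition wcard (K : finType) (alpha : K -> nat) (S : {set K}) : nat :=
  (\sum_(u in S) alpha u)%N.

Section Bound.
Local Open Scope ring_scope.

Definition Mterm (p n k : nat) : int :=
  k%:Z * n%:Z - p%:Z ^+ k.-1 * (k%:Z * (p%:Z - 1) - p%:Z).

Definition Madm (p n k : nat) : bool :=
  (1 <= k)%N && (p ^ k.-1 * (p - 1) <= n)%N.

(* For p >= 2 an admissible k is at most n and gives a term that is at least
   1, so neither the finite range nor the default value 1 affects the maximum:
   see M_max. *)
Definition M (p n : nat) : int :=
  if (p - 1 <= n)%N then \big[Num.max/1]_(k < n.+1 | Madm p n k) Mterm p n k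
  else 1.

Lemma num_filters_gt1 d (P : finPOrderType d) :
  (0 < #|P|)%N -> (1 < num_filters P)%N.
Proof.
move=> /card_gt0P[x _]; apply/card_gt1P; exists set0, setT; split.
- by rewrite inE; apply/forall_inP => y; rewrite inE.
- by rewrite inE; apply/forall_inP => y _; apply/forallP => z; rewrite inE implybT.
- by apply/eqP => /setP/(_ x); rewrite !inE.
Qed.

Lemma Madm_le p n k : (1 < p)%N -> Madm p n k -> (k <= n)%N.
Proof.
move=> p1 /andP[k1 H]; apply: leq_trans H.
have := ltn_expl k.-1 p1; have : (0 < p - 1)%N by lia.
nia.
Qed.

Lemma Mterm_ge1 p n k : (1 < p)%N -> Madm p n k -> 1 <= Mterm p n k.
Proof.
rewrite /Madm /Mterm => p1 /andP[k1 H].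
have p0 : (0 < p ^ k.-1)%N by rewrite expn_gt0; lia.
have -> : p%:Z ^+ k.-1 = (p ^ k.-1)%N%:Z.
  by elim: k.-1 => // m IH; rewrite exprS IH expnS PoszM.
have : (k * (p ^ k.-1 * (p - 1)) <= k * n)%N by rewrite leq_mul2l H orbT.
move: p0; set a := (p ^ _)%N => p0 kn.
have ap : (1 <= a * p)%N by rewrite muln_gt0 p0; lia.
nia.
Qed.

Lemma M_max p n : (1 < p)%N -> (p - 1 <= n)%N ->
  (exists2 k, Madm p n k & M p n = Mterm p n k) /\
  (forall k, Madm p n k -> Mterm p n k <= M p n).
Proof.
move=> p1 pn; rewrite /M pn.
have adm1 : Madm p n 1 by rewrite /Madm expn0 mul1n.
have ub k : Madm p n k ->
    Mterm p n k <= \big[Num.max/1]_(k < n.+1 | Madm p n k) Mterm p n k.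
  move=> Hk; have kn := Madm_le p1 Hk.
  exact: (@le_bigmax_cond _ _ _ _ (Ordinal (kn : (k < n.+1)%N))
            (fun i : 'I_n.+1 => Madm p n i) (fun i : 'I_n.+1 => Mterm p n i)).
split=> //.
have n1 : (1 < n.+1)%N by lia.
rewrite (@bigmax_eq_arg _ _ _ _ (Ordinal n1)
   (fun i : 'I_n.+1 => Madm p n i) (fun i : 'I_n.+1 => Mterm p n i)) //.
  case: arg_maxP => // i Hi _; by exists i.
by move=> i; apply: Mterm_ge1.
Qed.

End Bound.

(* Main.v *)
Require Import Defs.
From HB Require Import structures.
From mathcomp Require Import all_boot all_order all_algebra zify ring.
Set Implicit Arguments.
Unset Strict Implicit.
Unset Printing Implicit Defensive.
Import Order.TTheory GRing.Theory Num.Theory.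
Import Order.DefaultSetSubsetOrder.
Local Open Scope ring_scope.

(** Write [X a] for the complement of [[a)^P]. Choose an irredundant family
    [a_1, ..., a_k] of join-irreducibles with join the top of [L]. Every map
    other than the top one lies in some [X a_i]. By irredundance a tuple of
    filters [F_1, ..., F_k] of [P] is recovered from the map
    [x |-> \join_(i | x \in F_i) a_i], so [L^P] contains a copy of the [p ^ k]
    tuples, in which [X a_i] cuts out the tuples with [F_i != P]; hence
    [p ^ k.-1 * (p - 1) <= |X a_i| <= n]. Counting each map with the number of
    [X a_i] to which it belongs, the maps of the copy already account for an
    overcount of [k p ^ k.-1 (p - 1) - p ^ k], which gives the bound. There is
    equality when [L] is the Boolean lattice of rank [k] and all the excess
    weight is carried by maps that belong to exactly one [X a_i]. *)

(** * Irredundant families of join-irreducibles *)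

Section JoinIrreducibles.
Local Open Scope order_scope.
Variables (dL : Order.disp_t) (L : finTBLatticeType dL).

Definition ji_set : {set L} :=
  [set a | [forall v, forall w, (a == v `|` w) ==> (a == v) || (a == w)]].

Lemma ji_setP (a : L) : reflect (join_irreducible a) (a \in ji_set).
Proof.
rewrite inE; apply: (iffP forallP) => [H v w /eqP avw|H v].
  by move: (H v) => /forallP/(_ w)/implyP/(_ avw)/orP[]/eqP; [left|right].
apply/forallP => w; apply/implyP => /eqP /H [] <-; rewrite eqxx ?orbT //.
Qed.

(** Induction on the number of elements below [u]: if [u] is not join-irreducible, it is the join of
    two strictly smaller elements. *)
Lemma le_join_ji (u b : L) :
  (forall a, a \in ji_set -> a <= u -> a <= b) -> u <= b.
Proof.
have [m] := ubnP #|[set v | v < u]|; elim: m => // m IH in u *.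
rewrite ltnS => um Hb; have [/Hb|] := boolP (u \in ji_set); first exact.
rewrite inE negb_forall => /existsP[v]; rewrite negb_forall => /existsP[w].
rewrite negb_imply negb_or => /and3P[/eqP uvw uv uw].
have IHlt t : t < u -> t <= b.
  move=> tu; apply: IH => [|a aJ au]; last first.
    by apply: Hb; rewrite // (le_trans au) ?ltW.
  apply: leq_trans um; apply: proper_card; apply/properP; split.
    by apply/subsetP => s; rewrite !inE => /lt_trans; apply.
  by exists t; rewrite inE ?ltxx.
by rewrite uvw leUx !IHlt // lt_def ?uv ?uw {1}uvw ?leUl ?leUr.
Qed.

Definition independent (I : finType) (a : I -> L) :=
  forall (T : {set I}) i, a i <= \join_(j in T) a j -> i \in T.

(** Take an inclusion-minimal set of join-irreducibles with join [\top]. It is empty when [L] has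
    one point. *)
Lemma independent_ji_family :
  exists (I : finType) (a : I -> L),
    [/\ forall i, join_irreducible (a i), independent a
      & \join_i a i = \top].
Proof.
pose spanning (S : {set L}) := (S \subset ji_set) && (\join_(b in S) b == \top).
have /minset_exists[S /minsetP[/andP[Sji /eqP Stop] Smin] _] : spanning ji_set.
  rewrite /spanning subxx -le1x; apply: le_join_ji => a aJ _.
  exact: (@joins_sup _ _ _ a (mem ji_set) id).
have sum_val : \join_(i : {x | x \in S}) val i = \top.
  apply/eqP; rewrite -le1x -Stop; apply/joinsP => b bS.
  exact: (@joins_sup _ _ _ (exist _ b bS) xpredT val).
exists {x | x \in S}, val; split=> //.
  by move=> i; apply/ji_setP/(subsetP Sji)/valP.
move=> T i iT; apply/negPn/negP => iNT.
have joinT : \join_(j in T) val j <= \join_(b in S :\ val i) b.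
  apply/joinsP => j jT; apply: (@joins_sup _ _ _ (val j) _ id).
  by rewrite !inE (valP j) andbT (inj_eq val_inj); apply: contraNneq iNT => <-.
(* If [val i] lay below the join of the others, it could be dropped from [S], against minimality. *)
suff /Smin/(_ (subD1set _ _))/setP/(_ (val i)) : spanning (S :\ val i).
  by rewrite !inE eqxx (valP i).
rewrite /spanning (subset_trans (subD1set _ _) Sji) -le1x -Stop.
apply/joinsP => b bS; have [->|bi] := eqVneq b (val i).
  exact: le_trans iT joinT.
by apply: (@joins_sup _ _ _ b _ id); rewrite !inE bi.
Qed.

End JoinIrreducibles.

(** * Counting tuples of filters *)

Section FilterTuples.
Local Open Scope nat_scope.
Variables (dP : Order.disp_t) (P : finPOrderType dP) (I : finType).

Definition filters : {set {set P}} := [set F | is_filter F].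

Definition filter_tuples : {set {ffun I -> {set P}}} :=
  [set g : {ffun I -> {set P}} | [forall i, g i \in filters]].

Lemma is_filterP (F : {set P}) :
  reflect (forall x y, x \in F -> (x <= y)%O -> y \in F) (is_filter F).
Proof.
apply: (iffP forall_inP) => [H x y /H/forallP/(_ y)/implyP//|H x xF].
by apply/forallP => y; apply/implyP; apply: H.
Qed.

Lemma filters_setT : setT \in filters.
Proof. by rewrite inE; apply/is_filterP => x y _ _; rewrite inE. Qed.

Lemma card_filter_tuples : #|filter_tuples| = num_filters P ^ #|I|.
Proof.
rewrite -card_ffun_on; apply: eq_card => g; rewrite inE.
by apply/forallP/ffun_onP.
Qed.

Lemma card_proper_filter_tuples i :
  #|[set g in filter_tuples | g i != setT]|
    = num_filters P ^ #|I|.-1 * (num_filters P - 1).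
Proof.
(* The allowed values at coordinate [j]: only [i] loses the full filter. *)
pose D j := if j == i then filters :\ setT else filters.
have -> : #|[set g in filter_tuples | g i != setT]|
    = #|family (fun j => mem (D j))|.
  apply: eq_card => g; rewrite !inE; apply/andP/familyP.
    move=> [/forallP gf gi] j; rewrite /D; case: eqP => [->|_]; last exact: gf.
    by rewrite !inE gi; move: (gf i); rewrite inE.
  move=> gD; split.
    by apply/forallP => j; move: (gD j); rewrite /D; case: eqP => // _ /setD1P[].
  by move: (gD i); rewrite /D eqxx => /setD1P[].
rewrite card_family foldrE big_image /= (bigD1 i) //= mulnC; congr (_ * _).
  rewrite (eq_bigr (fun=> num_filters P)) => [|j /negPf ji]; last first.
    by rewrite /D ji; apply: eq_card.
  by rewrite prod_nat_const cardC1.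
have := cardsD1 setT filters.
rewrite filters_setT /num_filters -/filters add1n => ->.
by rewrite subn1 /= /D eqxx.
Qed.

End FilterTuples.

(** * The copy of the filter tuples in the lattice of maps *)

Section Copy.
Variables (dP dL : Order.disp_t) (P : finPOrderType dP) (L : finTBLatticeType dL).
Variables (I : finType) (a : I -> L).

(** The set called [X b] above, spelled as in the theorem so that its hypothesis applies by
    conversion. *)
Definition avoid (b : L) : {set {omap P -> L}} :=
  [set: {omap P -> L}] :\: maps_into P (upper_set b).

Lemma in_avoid b f : (f \in avoid b) = ~~ [forall x, (b <= f x)%O].
Proof.
by rewrite !inE andbT; congr (~~ _); apply: eq_forallb => x; rewrite inE.
Qed.

Definition tuple_of (f : {omap P -> L}) : {ffun I -> {set P}} :=
  [ffun i => [set x | (a i <= f x)%O]].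

(* Testing [g i] on all [y >= x] changes nothing when [g i] is a filter and
   makes the map order-preserving for an arbitrary [g]. *)
Fact map_of_subproof (g : {ffun I -> {set P}}) :
  @order_preserving _ _ P L
    [ffun x => \join_(i | [forall y, (x <= y)%O ==> (y \in g i)]) a i]%O.
Proof.
apply/forallP => x; apply/forallP => y; apply/implyP => xy; rewrite !ffunE.
apply/joinsP => i /forallP xi; apply: joins_sup; apply/forallP => z.
by apply/implyP => yz; move: (xi z); rewrite (le_trans xy yz).
Qed.

Definition map_of g : {omap P -> L} := OMap (map_of_subproof g).

Lemma map_ofE g x : g \in filter_tuples P I ->
  map_of g x = (\join_(i in [set i | x \in g i]) a i)%O.
Proof.
rewrite inE => /forallP gf; rewrite ffunE; apply: eq_bigl => i; rewrite inE.
apply/forallP/idP => [/(_ x)|xi y]; first by rewrite lexx.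
move: (gf i); rewrite inE => /is_filterP gi.
by apply/implyP; apply: gi.
Qed.

Lemma tuple_of_filters f : tuple_of f \in filter_tuples P I.
Proof.
rewrite inE; apply/forallP => i; rewrite inE; apply/is_filterP => x y.
by rewrite ffunE !inE => aif xy; apply: le_trans aif (omap_le f xy).
Qed.

Lemma tuple_of_setT f i : (tuple_of f i != setT) = (f \in avoid (a i)).
Proof.
rewrite in_avoid ffunE; congr (~~ _); apply/eqP/forallP => [H x|H].
  by move/setP/(_ x): H; rewrite !inE.
by apply/setP => x; rewrite !inE H.
Qed.

(** By independence, [a i] lies below the join of the [a j] with [x \in g j] only if [x \in g i]. *)
Lemma map_ofK : independent a ->
  {in filter_tuples P I, cancel map_of tuple_of}.
Proof.
move=> inda g gf; apply/ffunP => i; apply/setP => x.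
rewrite ffunE inE map_ofE //; apply/idP/idP => [/inda|xi]; first by rewrite inE.
by apply: joins_sup; rewrite inE.
Qed.

Definition copy : {set {omap P -> L}} := map_of @: filter_tuples P I.

Lemma card_copy : independent a -> #|copy| = (num_filters P ^ #|I|)%N.
Proof.
move=> inda; rewrite card_in_imset ?card_filter_tuples //.
exact: can_in_inj (map_ofK inda).
Qed.

Lemma card_copy_avoid i : independent a ->
  #|copy :&: avoid (a i)|
    = (num_filters P ^ #|I|.-1 * (num_filters P - 1))%N.
Proof.
move=> inda; rewrite -(card_proper_filter_tuples P i).
rewrite -(card_in_imset (f := map_of)); last first.
  move=> g h; rewrite !inE => /andP[gf _] /andP[hf _].
  by apply: (can_in_inj (map_ofK inda)); rewrite inE.
apply: eq_card => f; rewrite inE; apply/andP/imsetP => [[/imsetP[g gf ->]]|[g]].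
  by rewrite -tuple_of_setT map_ofK // => gi; exists g; rewrite // inE gf.
rewrite inE => /andP[gf gi] ->; split; first exact: imset_f.
by rewrite -tuple_of_setT map_ofK.
Qed.

(** A map in no [avoid P (a i)] is pointwise above every [a i], hence above their join. *)
Lemma avoid_eq0P f : (\join_i a i)%O = \top%O ->
  reflect (forall i, f \notin avoid (a i)) (f == \top%O).
Proof.
move=> atop; apply: (iffP eqP) => [-> i|H].
  by rewrite in_avoid negbK; apply/forallP => x; rewrite ffunE lex1.
apply/le_anti; rewrite lex1; apply/leomP => x; rewrite ffunE -atop.
apply/joinsP => i _; move: (H i); rewrite in_avoid negbK.
by move/forallP.
Qed.

Lemma top_in_copy : (\join_i a i)%O = \top%O -> \top%O \in copy.
Proof.
move=> atop; apply/imsetP; exists [ffun=> setT].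
  by rewrite inE; apply/forallP => i; rewrite ffunE filters_setT.
apply/esym/eqP/(avoid_eq0P _ atop) => i; rewrite in_avoid negbK.
apply/forallP => x; rewrite ffunE; apply: joins_sup; apply/forallP => y.
by rewrite ffunE inE implybT.
Qed.

End Copy.

(** * Weighted cardinalities and the terms of the bound *)

Lemma wcard_indicator (K : finType) (alpha : K -> nat) (S : {set K}) :
  wcard alpha S = (\sum_u (u \in S) * alpha u)%N.
Proof.
by rewrite /wcard big_mkcond; apply: eq_bigr => u _; case: (u \in S);
  rewrite ?mul1n ?mul0n.
Qed.

Lemma leq_card_wcard (K : finType) (alpha : K -> nat) (S T : {set K}) :
  (forall u, 0 < alpha u)%N -> S \subset T -> (#|S| <= wcard alpha T)%N.
Proof.
move=> alpha0 ST; apply: leq_trans (subset_leq_card ST) _.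
by rewrite -sum1_card; apply: leq_sum.
Qed.

(** A difference of naturals, so that comparisons with [Mterm] reduce to [nat]. *)
Lemma MtermE p n k : (0 < p)%N -> (0 < k)%N ->
  Mterm p n k = (k * n + p ^ k)%N%:Z - (k * (p ^ k.-1 * (p - 1)))%N%:Z.
Proof.
case: p k => // p [//|k] _ _; rewrite /Mterm /= expnS subn1 /=.
have -> : p.+1%:Z ^+ k = (p.+1 ^ k)%N%:Z.
  by elim: k => // k IH; rewrite exprS IH expnS PoszM.
by rewrite !PoszD !PoszM -addn1 PoszD; ring.
Qed.

(** * The upper bound by double counting *)

Section UpperBound.
Variables (dP dL : Order.disp_t) (P : finPOrderType dP) (L : finTBLatticeType dL).
Variables (I : finType) (a : I -> L) (alpha : {omap P -> L} -> nat) (n : nat).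
Hypotheses (inda : independent a) (atop : (\join_i a i)%O = \top%O).
Hypotheses (alpha_gt0 : multilattice alpha) (alpha_top : alpha \top%O = 1%N).
Hypothesis avoid_le : forall i, (wcard alpha (avoid P (a i)) <= n)%N.

Let p := num_filters P.

Lemma admissible_card (i : I) : Madm p n #|I|.
Proof.
rewrite /Madm; apply/andP; split; first by apply/card_gt0P; exists i.
rewrite -(card_copy_avoid P i inda); apply: leq_trans (avoid_le i).
by apply: leq_card_wcard; rewrite ?subsetIr.
Qed.

Lemma wcard_upper_bound :
  (wcard alpha setT + #|I| * (p ^ #|I|.-1 * (p - 1)) <= #|I| * n + p ^ #|I|)%N.
Proof.
(* The multiplicity with which the sets [avoid P (a i)] cover [f]. *)
pose c f := (\sum_i (f \in avoid P (a i)))%N.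
have sum_c : (\sum_f c f * alpha f <= #|I| * n)%N.
  under eq_bigr do rewrite big_distrl /=.
  rewrite exchange_big /= -sum_nat_const; apply: leq_sum => i _.
  by rewrite -wcard_indicator.
have sum_c_copy : (\sum_(f in copy P a) c f = #|I| * (p ^ #|I|.-1 * (p - 1)))%N.
  rewrite exchange_big /= -sum_nat_const; apply: eq_bigr => i _.
  rewrite -(card_copy_avoid P i inda) -sum1_card big_mkcond [RHS]big_mkcond /=.
  by apply: eq_bigr => f _; rewrite in_setI; case: (f \in copy P a).
rewrite -sum_c_copy; apply: leq_trans (leq_add sum_c (leqnn _)).
rewrite -(card_copy P inda) -sum1_card big_mkcond [X in (_ <= _ + X)%N]big_mkcond.
rewrite /wcard [X in (X + _ <= _)%N]big_mkcond [X in (_ + X <= _)%N]big_mkcond.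
(* Termwise, with [e] the indicator of the copy: [alpha f + e * c f <= c f * alpha f + e]. *)
rewrite -!big_split /=; apply: leq_sum => f _; rewrite inE.
(* Off the top [1 <= c f], so [(c f - 1) * (alpha f - 1) >= 0]. *)
have [->|ftop] := eqVneq f \top%O.
  (* At the top, [c f = 0] and both sides are 1. *)
  rewrite alpha_top top_in_copy // /c big1 // => i _.
  have /(avoid_eq0P _ atop)/(_ i)/negPf-> // := eqxx (\top%O : {omap P -> L}).
have c_gt0 : (0 < c f)%N.
  rewrite lt0n /c sum_nat_eq0; apply: contra ftop => /forallP f0.
  by apply/(avoid_eq0P _ atop) => i; move: (f0 i); rewrite eqb0.
have := alpha_gt0 f; case: ifP => _; nia.
Qed.

End UpperBound.

(** * Sharpness: weighted Boolean lattices *)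

Section BooleanLattice.
Variables (dP : Order.disp_t) (P : finPOrderType dP) (k : nat).

Let L : finTBLatticeType _ := {set 'I_k}.
Let atom (i : 'I_k) : L := [set i].

Lemma le_atom i (u : L) : (atom i <= u)%O = (i \in u).
Proof. exact: sub1set. Qed.

Lemma join_atoms (u : L) : u = (\join_(i in u) atom i)%O.
Proof.
apply/le_anti/andP; split; last by apply/joinsP => i; rewrite le_atom.
apply/subsetP => i iu; rewrite -le_atom.
exact: (@joins_sup _ _ _ i (mem u)).
Qed.

Lemma atom_independent : independent atom.
Proof. by move=> T i; rewrite -(join_atoms (T : L)) le_atom. Qed.

(** For [i \in b], split [b] into [atom i] and [b :\ i]; the latter misses [i], so it is not [b]. *)
Lemma join_irreducible_atom (b : L) :
  join_irreducible b -> b = \bot%O \/ exists i, b = atom i.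
Proof.
move=> bji; have [->|[i ib]] := set_0Vmem b.
  by left.
right; exists i.
have bE : b = (atom i `|` (b :\ i : L))%O.
  by rewrite Order.SetSubsetOrder.joinEsubset setD1K.
have [//|bD] := bji _ _ bE.
by move: ib; rewrite bD in_setD1 eqxx.
Qed.

(** Here the copy is everything, so the counts for the copy become exact counts for all maps. *)
Lemma copy_atom : copy P atom = setT.
Proof.
apply/setP => f; rewrite inE; apply/imsetP.
exists (tuple_of atom f); first exact: tuple_of_filters.
apply/val_inj/ffunP => x; rewrite [RHS]map_ofE ?tuple_of_filters //.
rewrite [LHS]join_atoms; apply: eq_bigl => i.
by rewrite inE ffunE inE le_atom.
Qed.

Lemma avoid_bot : avoid P (\bot%O : L) = set0.
Proof.
apply/setP => f; rewrite in_avoid inE; apply/negbTE; rewrite negbK.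
by apply/forallP => x; rewrite le0x.
Qed.

(** Lies in [avoid P (atom j)] for [j = i] only, so extra weight on it is counted once. *)
Definition coatom_map (i : 'I_k) : {omap P -> L} :=
  omap_const P (setT :\ i : L).

Hypothesis P_nonempty : (0 < #|P|)%N.

Lemma coatom_map_avoid i j : (coatom_map i \in avoid P (atom j)) = (i == j).
Proof.
rewrite in_avoid; have /card_gt0P[x _] := P_nonempty.
transitivity (~~ (atom j <= (setT :\ i : L)))%O.
  congr (~~ _); apply/forallP/idP => [/(_ x)|H y]; by rewrite ffunE.
by rewrite le_atom !inE andbT negbK eq_sym.
Qed.

Definition weight (d : nat) (f : {omap P -> L}) : nat :=
  (1 + d * \sum_i (f == coatom_map i))%N.

Lemma wcard_weight d (S : {set {omap P -> L}}) :
  wcard (weight d) S = (#|S| + d * \sum_i (coatom_map i \in S))%N.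
Proof.
rewrite /wcard /weight big_split /= sum1_card -big_distrr /= exchange_big /=.
congr (_ + d * _)%N; apply: eq_bigr => i _.
rewrite big_mkcond (bigD1 (coatom_map i)) //= eqxx big1 ?addn0 => [|f /negPf->].
  by case: (_ \in S).
by case: (_ \in S).
Qed.

Lemma weight_top d : weight d \top%O = 1%N.
Proof.
rewrite /weight big1 ?muln0 // => i _; apply/eqP; rewrite eqb0.
apply/eqP => topi; have := coatom_map_avoid i i.
rewrite -topi in_avoid eqxx => /negP[]; apply/forallP => x.
by rewrite ffunE lex1.
Qed.

Lemma wcard_weight_avoid d i :
  wcard (weight d) (avoid P (atom i))
    = (num_filters P ^ k.-1 * (num_filters P - 1) + d)%N.
Proof.
rewrite wcard_weight -[avoid _ _]setTI -copy_atom.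
rewrite (card_copy_avoid P i atom_independent) card_ord copy_atom setTI.
rewrite (bigD1 i) //= coatom_map_avoid eqxx big1 ?muln1 // => j /negPf ji.
by rewrite coatom_map_avoid ji.
Qed.

Lemma wcard_weight_setT d :
  wcard (weight d) setT = (num_filters P ^ k + d * k)%N.
Proof.
rewrite wcard_weight -copy_atom (card_copy P atom_independent) card_ord copy_atom.
by under eq_bigr do rewrite inE; rewrite sum1_card card_ord.
Qed.

Lemma weight_bound d n (b : L) :
  (num_filters P ^ k.-1 * (num_filters P - 1) + d <= n)%N ->
  join_irreducible b -> (wcard (weight d) (avoid P b) <= n)%N.
Proof.
move=> dn /join_irreducible_atom[->|[i ->]].
  by rewrite avoid_bot /wcard big_set0.
by rewrite wcard_weight_avoid.
Qed.

End BooleanLattice.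

Theorem theorem4p10p1 (dP : Order.disp_t) (P : finPOrderType dP)
    (P_nonempty : (0 < #|P|)%N) (n : nat) (n_ge1 : (1 <= n)%N) :
  (forall (dL : Order.disp_t) (L : finTBLatticeType dL)
      (alpha : {omap P -> L} -> nat),
    multilattice alpha ->
    alpha (\top)%O = 1%N ->
    (forall a : L, join_irreducible a ->
      (wcard alpha ([set: {omap P -> L}] :\: maps_into P (upper_set a)) <= n)%N) ->
    (wcard alpha [set: {omap P -> L}])%:Z <= M (num_filters P) n)
  /\
  (exists (dL : Order.disp_t) (L : finTBLatticeType dL)
      (alpha : {omap P -> L} -> nat),
    [/\ multilattice alpha,
        alpha (\top)%O = 1%N,
        forall a : L, join_irreducible a ->
          (wcard alpha ([set: {omap P -> L}] :\: maps_into P (upper_set a)) <= n)%N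
      & (wcard alpha [set: {omap P -> L}])%:Z = M (num_filters P) n]).
Proof.
have p_gt1 := num_filters_gt1 P_nonempty; set p := num_filters P in p_gt1 *.
have adm_ge k : Madm p n k -> (p - 1 <= n)%N.
  by move=> /andP[_]; apply/leq_trans/leq_pmull; rewrite expn_gt0; lia.
split=> [dL L alpha alpha_gt0 alpha_top ji_le|].
  have [I [a [aji inda atop]]] := independent_ji_family L.
  have avoid_le i := ji_le _ (aji i).
  have ub := wcard_upper_bound inda atop alpha_gt0 alpha_top avoid_le.
  case: (pickP I) => [i _|I0].
    have adm := admissible_card inda alpha_gt0 avoid_le i.
    have [_ /(_ _ adm)] := M_max p_gt1 (adm_ge _ adm); apply: le_trans.
    rewrite MtermE; [|by lia|by case/andP: adm].
    by rewrite lerBrDr -PoszD lez_nat.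
  (* With [I] empty, [ub] says that the total weight is at most [p ^ 0 = 1]. *)
  have M_ge1 : 1 <= M p n.
    rewrite /M; case: ifP => // pn; exact: bigmax_ge_id.
  apply: le_trans M_ge1; rewrite lez_nat.
  by move: ub; rewrite (eq_card0 I0) !mul0n addn0.
(* For [k = 0] there are no atoms and only [\bot] is to be checked; the inequality may then fail
   because [k.-1 = 0]. *)
have reduce k d : (p ^ k.-1 * (p - 1) + d <= n)%N \/ k = 0%N ->
    (p ^ k + d * k)%N%:Z = M p n ->
    exists (dL : Order.disp_t) (L : finTBLatticeType dL)
      (alpha : {omap P -> L} -> nat),
    [/\ multilattice alpha, alpha \top%O = 1%N,
        forall a : L, join_irreducible a -> (wcard alpha (avoid P a) <= n)%N
      & (wcard alpha setT)%:Z = M p n].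
  move=> dn Mpn; exists _, {set 'I_k}, (@weight _ P k d).
  split=> //; first exact: weight_top.
    case: dn => [dn b|k0]; first exact: weight_bound.
    move=> b /join_irreducible_atom[->|[i _]].
      by rewrite avoid_bot /wcard big_set0.
    by have := ltn_ord i; lia.
  by rewrite wcard_weight_setT.
(* If [n < p - 1], the one-point lattice attains the value 1. *)
have [pn|pn] := leqP (p - 1) n; last first.
  apply: (reduce 0%N 0%N); first by right.
  by rewrite /M leqNgt pn.
have [[k adm Mk] _] := M_max p_gt1 pn.
have /andP[k_gt0 le_n] := adm.
(* For a maximizing [k], this [d] brings each [avoid P (atom i)] to weight exactly [n]. *)
apply: (reduce k (n - p ^ k.-1 * (p - 1))%N); first by left; rewrite subnKC.
rewrite Mk MtermE ?(ltnW p_gt1) //; nia.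
Qed.
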